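(* Let $K\subset\mathbb{R}^2$ be a compact convex set with boundary of class $C^2$ and of area $F$, and suppose that for some $\alpha\in(0,\pi)$ the isotopic set $C_\alpha$ of $K$ is a circle of radius $R$. Then $$F\leq F_{R}\,\sin^{2}\left(\frac{\alpha}{2}\right),\qquad\text{where } F_{R}=\pi R^{2}.$$
   Context: The visual angle $w(P)$ of $K$ from a point $P\notin K$ is the angle in $(0,\pi)$ under which $K$ is seen from $P$, i.e. the angle at $P$ of the smallest angular sector with vertex $P$ containing $K$ (the angle between the two support lines of $K$ through $P$). The isotopic set is $C_\alpha=\{P\in\mathbb{R}^2\setminus K: w(P)=\alpha\}$. *)

(* Defs.v *)
From HB Require Import structures.
From mathcomp Require Import all_boot all_order all_algebra.
From mathcomp Require Import all_classical all_reals all_analysis.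

Set Implicit Arguments.
Unset Strict Implicit.
Unset Printing Implicit Defensive.

Import Order.TTheory GRing.Theory Num.Theory.
Import numFieldNormedType.Exports.

Local Open Scope classical_set_scope.
Local Open Scope ring_scope.

(* [R^o] gives the plane its R-module structure.  The library norm on a product
   is the sup norm, so Euclidean notions are written in coordinates. *)
Definition plane (R : realType) := (R^o * R^o)%type.

Definition area (R : realType) (A : set (plane R)) : \bar R :=
  (@lebesgue_measure R \x @lebesgue_measure R)%E A.

Definition circle (R : realType) (c : plane R) (rho : R) : set (plane R) :=
  [set P | (P.1 - c.1) ^+ 2 + (P.2 - c.2) ^+ 2 = rho ^+ 2].

Definition boundary (T : topologicalType) (A : set T) : set T :=
  closure A `\` A°.

Definition C2_near (R : realType) (g : R -> R) (x : R) : Prop :=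
  \forall t \near x,
    [/\ derivable g t 1, derivable (derive1 g) t 1 & {for t, continuous (derive1n 2 g)}].

(* The boundary is a one-dimensional C^2 submanifold of the plane: near each of
   its points it is a C^2 graph over one of the two coordinate axes. *)
Definition C2_boundary (R : realType) (K : set (plane R)) : Prop :=
  forall p, boundary K p ->
    (exists g : R -> R, C2_near g p.1 /\
       \forall q \near p, boundary K q <-> q.2 = g q.1) \/
    (exists g : R -> R, C2_near g p.2 /\
       \forall q \near p, boundary K q <-> q.1 = g q.2).

(* Closed angular sector with vertex [P] and opening [w], starting from the
   direction [theta]. *)
Definition sector (R : realType) (P : plane R) (theta w : R) : set (plane R) :=
  [set Q | exists r t : R, [/\ 0 <= r, theta <= t <= theta + w &
     Q = (P.1 + r * cos t, P.2 + r * sin t)]].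

(* For [K] compact and [P] outside [K] the infimum is attained, so this is the
   opening of the smallest sector. *)
Definition visual_angle (R : realType) (K : set (plane R)) (P : plane R) : R :=
  inf [set w : R | 0 <= w /\ exists theta, K `<=` sector P theta w].

Definition isotopic_set (R : realType) (K : set (plane R)) (alpha : R)
  : set (plane R) :=
  [set P | ~ K P /\ visual_angle K P = alpha].

(* Main.v *)
Require Import Defs.
From HB Require Import structures.
From mathcomp Require Import all_boot all_order all_algebra.
From mathcomp Require Import all_classical all_reals all_analysis.
From mathcomp Require Import measurable_realfun ring lra.
Import Order.TTheory GRing.Theory Num.Theory.
Import numFieldNormedType.Exports.
Local Open Scope classical_set_scope.
Local Open Scope ring_scope.

(* Let [n t = (- sin t, cos t)] and let [<., .>] be the scalar product.  For
   every [psi], the support lines of [K] bounding the half-planes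
   [<q, n psi> >= a] and [<q, n (psi + alpha)> <= b] meet at a point [P] from
   which [K] is seen under the angle [alpha]; [P] is not in [K], because the
   boundary has no corners.  So [P] is on the given circle, of centre [c], and
   [b - a - <c, n (psi + alpha) - n psi> <= rho |n (psi + alpha) - n psi|
   = 2 rho sin (alpha / 2)].
   In terms of the body [B] obtained from [K] by the rotation of angle
   [- (alpha + pi)], this says that the half-sum of [K] and [B] lies in a disc
   of radius [rho sin (alpha / 2)].  As [K] and [B] have the same area, the
   Brunn-Minkowski inequality bounds that area by the area of the disc. *)

(** * Planar measure, shears and rotations *)

Notation plane_measurable A :=
  (measurable (A : set (measurableTypeR _ * measurableTypeR _)%type)).

(** The pushforward by a translation agrees with the Lebesgue measure on half-open intervals, and
    these values determine the measure. *)
Lemma lebesgue_measure_shift {R : realType} (c : R) (A : set R) :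
  measurable A -> lebesgue_measure ((fun y => y + c) @^-1` A) = lebesgue_measure A.
Proof.
move=> mA.
have mf : measurable_fun [set: measurableTypeR R]
    (fun y : measurableTypeR R => y + c : measurableTypeR R).
  by apply: continuous_measurable_fun => x; apply: cvgD; [exact: cvg_id|exact: cvg_cst].
pose mu' := pushforward (@lebesgue_measure R)
  (fun y : measurableTypeR R => y + c : measurableTypeR R).
change (mu' A = lebesgue_measure A).
apply/esym; apply: (@lebesgue_measure_unique R mu') => // _ [[a b]] _ <-.
transitivity (lebesgue_measure `](a - c), (b - c)]%classic); last first.
  congr (lebesgue_measure _); apply/seteqP.
  by split=> x /=; rewrite !in_itv/= ltrBlDr lerBrDr.
rewrite !lebesgue_measure_itv/= !lte_fin ltrD2r.
by case: ifPn => // _; congr (_%:E); ring.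
Qed.

(** The open boxes with rational corners contained in [A] are countably many and cover it. *)
Lemma open_plane_measurable {R : realType} (A : set (plane R)) :
  open A -> plane_measurable A.
Proof.
move=> oA.
pose I := ((rat * rat) * (rat * rat))%type.
pose box (i : I) : set (plane R) :=
  `](ratr i.1.1), (ratr i.1.2)[%classic `*` `](ratr i.2.1), (ratr i.2.2)[%classic.
pose D := [set i : I | box i `<=` A].
have itvnbhs (x : R) (U : set R) : nbhs x U ->
    exists a, exists b : rat, `](ratr a), (ratr b)[%classic x /\
      `](ratr a), (ratr b)[%classic `<=` U.
  move=> /nbhs_ballP[e /= e0 xU].
  have [a /[!in_itv]/= /andP[xa ax]] : exists q : rat, ratr q \in `](x - e), x[.
    by apply: rat_in_itvoo; rewrite ltrBlDr ltrDl.
  have [b /[!in_itv]/= /andP[xb bx]] : exists q : rat, ratr q \in `]x, (x + e)[.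
    by apply: rat_in_itvoo; rewrite ltrDl.
  exists a, b; split; first by rewrite /= in_itv/= ax xb.
  move=> y /=; rewrite in_itv/= => /andP[ay yb]; apply: xU.
  rewrite /ball /= ltr_norml; apply/andP; split; lra.
have -> : A = \bigcup_(i in D) box i.
  apply/seteqP; split=> [[x y] Axy|z [i Di zi]]; last exact: Di.
  have [[U V] /= [xU yV] UVA] := open_nbhs_nbhs (conj oA Axy).
  have [a [b [xab abU]]] := itvnbhs _ _ xU.
  have [c [d [ycd cdV]]] := itvnbhs _ _ yV.
  exists ((a, b), (c, d)); last by split.
  by move=> [u v] /= [/= uab vcd]; apply: UVA; split; [exact: abU|exact: cdV].
rewrite bigcup_mkcond; apply: countable_bigcupT_measurable => [|i].
  exact: countableP.
by case: ifPn => // _; apply: measurableX; exact: measurable_itv.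
Qed.

Lemma closed_plane_measurable {R : realType} (A : set (plane R)) :
  closed A -> plane_measurable A.
Proof.
move=> cA; rewrite -(setCK A); apply: measurableC.
by apply: open_plane_measurable; exact: closed_openC.
Qed.

Lemma compact_plane_closed {R : realType} (A : set (plane R)) :
  compact A -> closed A.
Proof. by apply: compact_closed; exact: norm_hausdorff. Qed.

Local Open Scope ereal_scope.

Lemma area_xsection {R : realType} (A : set (plane R)) :
  area A = \int[@lebesgue_measure R]_x lebesgue_measure (xsection A x).
Proof. by []. Qed.

(** Integrating in the other order gives a measure with the same values on rectangles, and the
    product measure is unique. *)
Lemma area_ysection {R : realType} (A : set (plane R)) : plane_measurable A ->
  area A = \int[@lebesgue_measure R]_y lebesgue_measure (ysection A y).
Proof.
move=> mA; apply: (@product_measure_unique _ _ _ _ _ _ _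
  ((@lebesgue_measure R) \x^ (@lebesgue_measure R))) mA => // B C mB mC.
exact: product_measure2E.
Qed.

Local Close Scope ereal_scope.

Lemma area_vertical_shear {R : realType} (k : R) (A : set (plane R)) :
  plane_measurable A ->
  area ((fun q : plane R => (q.1, q.2 + k * q.1) : plane R) @^-1` A) = area A.
Proof.
move=> mA; rewrite !area_xsection; apply: eq_integral => x _.
rewrite -[RHS](@lebesgue_measure_shift R (k * x)); last exact: measurable_xsection.
by congr (lebesgue_measure _); apply/seteqP; split=> y; rewrite /xsection /= !inE.
Qed.

Lemma area_horizontal_shear {R : realType} (k : R) (A : set (plane R)) :
  plane_measurable A ->
  plane_measurable ((fun q : plane R => (q.1 + k * q.2, q.2) : plane R) @^-1` A) ->
  area ((fun q : plane R => (q.1 + k * q.2, q.2) : plane R) @^-1` A) = area A.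
Proof.
move=> mA mB; rewrite !area_ysection //; apply: eq_integral => y _.
rewrite -[RHS](@lebesgue_measure_shift R (k * y)); last exact: measurable_ysection.
by congr (lebesgue_measure _); apply/seteqP; split=> x; rewrite /ysection /= !inE.
Qed.

Lemma continuous_linear_plane {R : realType} (a b c d : R) :
  continuous (fun q : plane R => (a * q.1 + b * q.2, c * q.1 + d * q.2) : plane R).
Proof.
move=> q; apply: (@cvg_pair _ _ _ _ (nbhs (a * q.1 + b * q.2 : R^o))
  (nbhs (c * q.1 + d * q.2 : R^o)));
  apply: cvgD; apply: cvgM; try exact: cvg_cst; try exact: cvg_fst; exact: cvg_snd.
Qed.

Definition rotation {R : realType} (t : R) (q : plane R) : plane R :=
  (cos t * q.1 - sin t * q.2, sin t * q.1 + cos t * q.2).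

Lemma continuous_rotation {R : realType} (t : R) : continuous (@rotation R t).
Proof.
rewrite (_ : @rotation R t = fun q : plane R =>
  (cos t * q.1 + (- sin t) * q.2, sin t * q.1 + cos t * q.2) : plane R).
  exact: continuous_linear_plane.
by apply/funext => q; rewrite /rotation mulNr.
Qed.

(* A rotation is a product of three shears. *)
Lemma area_rotation {R : realType} (t : R) (A : set (plane R)) :
  sin t != 0 -> closed A -> area (@rotation R t @^-1` A) = area A.
Proof.
move=> st cA.
(* This is [- tan (t / 2)], the slope for which the rotation equals [h \o v \o h]. *)
pose k := (cos t - 1) / sin t.
pose h (q : plane R) : plane R := (q.1 + k * q.2, q.2).
pose v (q : plane R) : plane R := (q.1, q.2 + sin t * q.1).
have ch : continuous h.
  rewrite (_ : h = fun q : plane R => (1 * q.1 + k * q.2, 0 * q.1 + 1 * q.2) : plane R).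
    exact: continuous_linear_plane.
  by apply/funext => q; rewrite /h !mul1r mul0r add0r.
have cv : continuous v.
  rewrite (_ : v = fun q : plane R => (1 * q.1 + 0 * q.2, sin t * q.1 + 1 * q.2) : plane R).
    exact: continuous_linear_plane.
  by apply/funext => q; rewrite /v !mul1r mul0r addr0 addrC.
have -> : @rotation R t @^-1` A = h @^-1` (v @^-1` (h @^-1` A)).
  suff -> : @rotation R t = h \o v \o h by [].
  have cs : cos t ^+ 2 + sin t ^+ 2 = 1 by exact: cos2Dsin2.
  have ks : k * sin t = cos t - 1 by rewrite /k divfK.
  have kc : k * (1 + cos t) = - sin t.
    by apply: (mulIf st); rewrite -mulrA (mulrC (1 + _)) mulrA ks; lra.
  have e1 (x y : R) : cos t * x - sin t * y =
      x + k * y + k * (y + sin t * (x + k * y)).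
    transitivity ((1 + k * sin t) * x + (k * (1 + (1 + k * sin t))) * y); last by ring.
    by rewrite ks [1 + (_ - _)]addrC subrK kc; ring.
  have e2 (x y : R) : sin t * x + cos t * y = y + sin t * (x + k * y).
    transitivity (sin t * x + (1 + k * sin t) * y); last by ring.
    by rewrite ks; ring.
  by apply/funext => -[x y]; congr pair; [exact: e1|exact: e2].
have c1 : closed (h @^-1` A) by apply: preimage_closed => // x _; exact: ch.
have c2 : closed (v @^-1` (h @^-1` A)) by apply: preimage_closed => // x _; exact: cv.
have c3 : closed (h @^-1` (v @^-1` (h @^-1` A))).
  by apply: preimage_closed => // x _; exact: ch.
rewrite area_horizontal_shear; try exact: closed_plane_measurable.
rewrite area_vertical_shear; last exact: closed_plane_measurable.
by rewrite area_horizontal_shear //; exact: closed_plane_measurable.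
Qed.

(** * The Brunn-Minkowski inequality for bodies of equal area *)

Local Open Scope ereal_scope.

Lemma lebesgue_measure_le_diam {R : realType} (I : set R) (a b : R) :
  (a <= b)%R -> I `<=` `[a, b]%classic -> measurable I ->
  lebesgue_measure I <= (b - a)%:E.
Proof.
move=> ab Iab mI.
have : lebesgue_measure I <= lebesgue_measure `[a, b]%classic.
  by apply: le_measure => //; rewrite inE.
rewrite lebesgue_measure_itv /= lte_fin.
case: ifPn => [_|]; first by rewrite EFinB.
by rewrite -leNgt => ba /le_trans; apply; rewrite lee_fin subr_ge0.
Qed.

(** The one-dimensional Brunn-Minkowski inequality for intervals. The open interval between the
    combined end points lies in [Z] and already has the required length, whichever of their end
    points [I] and [J] contain. *)
Lemma lebesgue_measure_interpolate {R : realType} (I J Z : set R) (m : R) :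
  (0 <= m <= 1)%R -> I !=set0 -> J !=set0 ->
  is_interval I -> is_interval J -> bounded_set I -> bounded_set J ->
  measurable Z ->
  (forall i j, I i -> J j -> Z ((1 - m) * i + m * j)%R) ->
  (1 - m)%:E * lebesgue_measure I + m%:E * lebesgue_measure J
    <= lebesgue_measure Z.
Proof.
move=> /andP[m0 m1] I0 J0 iI iJ bI bJ mZ IJZ.
have key (X : set R) : X !=set0 -> is_interval X -> bounded_set X ->
    [/\ (inf X <= sup X)%R, lebesgue_measure X <= (sup X - inf X)%:E &
      forall s : R, (0 < s < 1)%R -> X ((1 - s) * inf X + s * sup X)%R].
  move=> X0 iX bX.
  have [M [_ XM]] := bX.
  have {}XM x : X x -> (`|x| <= M + 1)%R.
    by move=> Xx; apply: (XM (M + 1)%R) => //; rewrite ltrDl.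
  have hs : has_sup X.
    by split => //; exists (M + 1)%R => x /XM; rewrite ler_norml => /andP[].
  have hi : has_inf X.
    by split => //; exists (- (M + 1))%R => x /XM; rewrite ler_norml => /andP[].
  have [x0 Xx0] := X0.
  have is_ : (inf X <= sup X)%R.
    by apply: (@le_trans _ _ x0); [apply: ge_inf => //; case: hi|apply: ub_le_sup => //; case: hs].
  split=> //.
    apply: lebesgue_measure_le_diam => //; last exact: is_interval_measurable.
    move=> x Xx /=; rewrite in_itv/=; apply/andP; split.
      by apply: ge_inf => //; case: hi.
    by apply: ub_le_sup => //; case: hs.
  move=> s /andP[s0 s1].
  (* If the bounds coincide, [X] is a single point and so is every combination of the bounds. *)
  have [e|ne] := eqVneq (inf X) (sup X).
    suff -> : ((1 - s) * inf X + s * sup X)%R = x0 by [].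
    have : (inf X <= x0)%R by apply: ge_inf => //; case: hi.
    have : (x0 <= sup X)%R by apply: ub_le_sup => //; case: hs.
    rewrite e => u v; have -> : x0 = sup X by apply/eqP; rewrite eq_le u v.
    by ring.
  have lt_is : (inf X < sup X)%R by rewrite lt_neqAle ne.
  set z := (_ + _)%R.
  have [x Xx xz] : exists2 x, X x & (x < z)%R.
    apply: inf_lt => //; rewrite /z; nra.
  have [y Xy zy] : exists2 y, X y & (z < y)%R.
    apply: sup_gt => //; rewrite /z; nra.
  by apply: (iX x y Xx Xy); rewrite !ltW.
have [leI mI pI] := key _ I0 iI bI.
have [leJ mJ pJ] := key _ J0 iJ bJ.
set a := ((1 - m) * inf I + m * inf J)%R.
set b := ((1 - m) * sup I + m * sup J)%R.
have ab : (a <= b)%R by rewrite /a /b; nra.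
have abZ : `]a, b[%classic `<=` Z.
  move=> z /=; rewrite in_itv/= => /andP[az zb].
  have ab' : (0 < b - a)%R by rewrite subr_gt0 (lt_trans az).
  (* The points of [I] and [J] with the same relative position [s] as [z] in []a, b[] combine to
     [z]. *)
  pose s := ((z - a) / (b - a))%R.
  have s0 : (0 < s)%R by rewrite divr_gt0 // subr_gt0.
  have s1 : (s < 1)%R by rewrite ltr_pdivrMr // mul1r ltrD2r.
  have s01 : (0 < s < 1)%R by rewrite s0.
  have -> : z = ((1 - m) * ((1 - s) * inf I + s * sup I) +
     m * ((1 - s) * inf J + s * sup J))%R.
    transitivity (a + s * (b - a))%R; last by rewrite /a /b; ring.
    by rewrite /s divfK ?gt_eqF // addrC subrK.
  by apply: IJZ; [exact: pI|exact: pJ].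
have leZ : (b - a)%:E <= lebesgue_measure Z.
  have : lebesgue_measure `]a, b[%classic <= lebesgue_measure Z.
    by apply: le_measure => //; rewrite inE.
  apply: le_trans; rewrite lebesgue_measure_itv /= lte_fin.
  case: ifPn => [_|]; first by rewrite EFinB.
  by rewrite -leNgt => ba; rewrite lee_fin subr_le0.
apply: le_trans leZ.
apply: (@le_trans _ _ ((1 - m)%:E * (sup I - inf I)%:E + m%:E * (sup J - inf J)%:E)).
  by apply: leeD; apply: lee_wpmul2l => //; rewrite lee_fin ?subr_ge0.
by rewrite -!EFinM -EFinD lee_fin /a /b; nra.
Qed.

(* Level regions and the layer-cake formula *)
Local Close Scope ereal_scope.

(** Cut at level [s] the region gives the superlevel set [s * k < f x]; cut at [x] it gives, for [f]
    nonnegative and [k] positive, an interval of length [Num.min 1 (f x / k)]. Measuring it both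
    ways yields the layer-cake formula. Levels are fractions of [k], so that bodies with different
    maximal sections can be compared at the same [s]. *)
Definition level_region {R : realType} (f : R -> R) (k : R) : set (plane R) :=
  [set q | 0 <= q.2 < 1 /\ q.2 * k < f q.1].

Lemma measurable_level_region {R : realType} (f : measurableTypeR R -> R) (k : R) :
  measurable_fun setT f -> plane_measurable (level_region f k).
Proof.
move=> mf.
have -> : level_region f k = (setT `*` `[0, 1[%classic) `&`
    (fun q : measurableTypeR R * measurableTypeR R => q.2 * k < f q.1) @^-1` [set true].
  apply/seteqP; split=> q; rewrite /level_region /= in_itv/=.
    by move=> [? ?]; split.
  by move=> [[_ ?] ?]; split.
apply: measurableI; first by apply: measurableX => //; exact: measurable_itv.
rewrite -[X in measurable X]setTI.
apply: measurable_fun_ltr => //.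
  by apply: measurable_funM => //; exact: measurable_snd.
exact: (measurableT_comp mf measurable_fst).
Qed.

Lemma ysection_level_region {R : realType} (f : R -> R) (k s : R) :
  0 <= s < 1 -> ysection (level_region f k) s = [set x | s * k < f x].
Proof.
move=> s01; apply/seteqP; split=> x; rewrite /ysection /= inE /level_region /=.
  by case.
by [].
Qed.

Local Open Scope ereal_scope.

Lemma measurable_superlevel_length {R : realType} (f : measurableTypeR R -> R) (k : R) :
  measurable_fun setT f ->
  measurable_fun (`[0%R, 1%R[%classic : set (measurableTypeR R))
    (fun s => lebesgue_measure [set x | (s * k < f x)%R]).
Proof.
move=> mf.
apply: (@eq_measurable_fun _ _ _ _ _ (fun s => lebesgue_measure (ysection (level_region f k) s))).
  by move=> s; rewrite inE /= in_itv/= => s01; rewrite ysection_level_region.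
apply: measurable_funTS.
exact: (measurable_fun_ysection (@lebesgue_measure R) (measurable_level_region f k mf)).
Qed.

Lemma integral_superlevel_length {R : realType} (f : measurableTypeR R -> R) (k : R) :
  (0 < k)%R -> measurable_fun setT f -> (forall x, 0 <= f x)%R ->
  \int[@lebesgue_measure R]_(s in `[0%R, 1%R[) lebesgue_measure [set x | (s * k < f x)%R]
  = \int[@lebesgue_measure R]_x (Num.min 1 (f x / k))%:E.
Proof.
move=> k0 mf f0.
have mG := measurable_level_region f k mf.
transitivity (area (level_region f k)).
  rewrite (area_ysection _ mG) [LHS]integral_mkcond; apply: eq_integral => s _.
  rewrite patchE; case: ifPn => [|/negP]; rewrite inE /= in_itv/= => hs.
    by rewrite ysection_level_region.
  rewrite (_ : ysection _ s = set0) ?measure0 //.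
  by apply/seteqP; split=> x; rewrite /ysection /= ?inE // /level_region /= => -[].
rewrite area_xsection; apply: eq_integral => x _.
have -> : xsection (level_region f k) x = `[0%R, Num.min 1%R (f x / k)%R[%classic.
  apply/seteqP; split=> s;
    rewrite /xsection /= inE /level_region /= in_itv/= lt_min ltr_pdivlMr //.
    by move=> [/andP[-> ->] ->].
  by move=> /andP[-> /andP[-> ->]].
rewrite lebesgue_measure_itv /= lte_fin; case: ifPn; first by rewrite sube0.
(* The interval is empty here; as [f] is nonnegative, the minimum is then [0]. *)
rewrite -leNgt => h; congr (_%:E); apply/eqP; rewrite eq_le h le_min ler01 /=.
by rewrite divr_ge0 // ltW.
Qed.

(* Section lengths of compact convex sets *)
Local Close Scope ereal_scope.

Definition plane_convex {R : realType} (C : set (plane R)) :=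
  forall p q m, 0 <= m <= 1 -> C p -> C q ->
    C ((1 - m) * p.1 + m * q.1, (1 - m) * p.2 + m * q.2).

Lemma is_interval_segment {R : realType} (I : set R) :
  (forall x y m, 0 <= m <= 1 -> I x -> I y -> I ((1 - m) * x + m * y)) ->
  is_interval I.
Proof.
move=> cI x y Ix Iy z /andP[xz zy].
have [e|ne] := eqVneq x y.
  by have -> : z = x by apply/eqP; rewrite eq_le xz e zy.
have xy : 0 < y - x by rewrite subr_gt0 lt_neqAle ne (le_trans xz).
have -> : z = (1 - (z - x) / (y - x)) * x + ((z - x) / (y - x)) * y.
  transitivity (x + (z - x) / (y - x) * (y - x)); last by ring.
  by rewrite divfK ?gt_eqF // addrC subrK.
apply: cI => //; apply/andP; split; first by rewrite divr_ge0 ?subr_ge0 // (le_trans xz).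
by rewrite ler_pdivrMr // mul1r lerD2r.
Qed.

Lemma compact_plane_bounded {R : realType} (C : set (plane R)) : compact C ->
  exists2 N : R, 0 < N & forall q, C q -> `|q.1| <= N /\ `|q.2| <= N.
Proof.
move=> /compact_bounded[M [_ CM]].
exists (`|M| + 1); first by rewrite ltr_pwDr.
move=> q Cq.
have : `|q| <= `|M| + 1.
  by apply: (CM (`|M| + 1)) => //; rewrite ltr_pwDr // ler_norm.
by rewrite prod_normE ge_max => /andP[].
Qed.

(** For compact [C] the length is finite, so [fine] loses nothing; this is [section_lengthE]. *)
Definition section_length {R : realType} (C : set (plane R)) (x : R) : R :=
  fine (lebesgue_measure (xsection C x)).

Section compact_sections.
Context {R : realType} (C : set (plane R)) (cC : compact C).

Let mC : plane_measurable C.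
Proof. by apply: closed_plane_measurable; exact: compact_plane_closed. Qed.

Lemma measurable_compact_xsection (x : R) :
  measurable (xsection C x : set (measurableTypeR R)).
Proof. exact: measurable_xsection. Qed.

Lemma section_lengthE (x : R) :
  lebesgue_measure (xsection C x) = (section_length C x)%:E.
Proof.
have [N N0 CN] := compact_plane_bounded _ cC.
rewrite fineK // ge0_fin_numE //.
apply: le_lt_trans (ltry (N - - N)).
apply: lebesgue_measure_le_diam; first by rewrite ge0_cp // ltW.
  move=> y; rewrite /xsection /= inE => /CN[_].
  by rewrite in_itv/= ler_norml.
exact: measurable_compact_xsection.
Qed.

Lemma section_length_ge0 (x : R) : 0 <= section_length C x.
Proof. by rewrite -lee_fin -section_lengthE. Qed.

Lemma measurable_section_length :
  measurable_fun setT (section_length C : measurableTypeR R -> R).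
Proof.
apply/measurable_EFinP.
rewrite (_ : EFin \o _ = fun x => lebesgue_measure (xsection C x)).
  exact: (measurable_fun_xsection (@lebesgue_measure R)).
by apply/funext => x; rewrite section_lengthE.
Qed.

Lemma area_section_length :
  area C = (\int[@lebesgue_measure R]_x (section_length C x)%:E)%E.
Proof. by rewrite area_xsection; apply: eq_integral => x _; rewrite section_lengthE. Qed.

Lemma section_length_bounded :
  exists2 N : R, 0 < N & forall x, section_length C x <= N /\
    (0 < section_length C x -> `|x| <= N).
Proof.
have [N N0 CN] := compact_plane_bounded _ cC.
(* One constant serves for the lengths, at most [N + N], and for the abscissas where they are
   positive, at most [N]. *)
exists (N + N); first by rewrite addr_gt0.
move=> x; split.
  rewrite -lee_fin -section_lengthE -[X in N + X]opprK.
  apply: lebesgue_measure_le_diam; first by rewrite ge0_cp // ltW.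
    move=> y; rewrite /xsection /= inE => /CN[_].
    by rewrite in_itv/= ler_norml.
  exact: measurable_compact_xsection.
move=> l0; apply: (@le_trans _ _ N); last by rewrite lerDl ltW.
have [e|/set0P[y]] := eqVneq (xsection C x) set0.
  by move: l0; rewrite /section_length e measure0 ltxx.
by rewrite /xsection /= inE => /CN[].
Qed.

Lemma section_length_neq0 (x : R) : 0 < section_length C x -> xsection C x !=set0.
Proof.
move=> l0; apply/set0P/eqP => e.
by move: l0; rewrite /section_length e measure0 ltxx.
Qed.

Lemma bounded_xsection (x : R) : bounded_set (xsection C x).
Proof.
have [N N0 CN] := compact_plane_bounded _ cC.
exists N; split; first by rewrite num_real.
by move=> M NM y; rewrite /xsection /= inE => /CN[_ /le_trans]; apply; exact: ltW.
Qed.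

Lemma bounded_superlevel (t : R) :
  0 <= t -> bounded_set [set x | t < section_length C x].
Proof.
move=> t0; have [N N0 CN] := section_length_bounded.
exists N; split; first by rewrite num_real.
move=> M NM x /= tx; have [_ /(_ (le_lt_trans t0 tx))] := CN x.
by move=> /le_trans; apply; exact: ltW.
Qed.

Context (vC : plane_convex C).

Lemma is_interval_xsection (x : R) : is_interval (xsection C x).
Proof.
apply: is_interval_segment => y z m m01; rewrite /xsection /= !inE => Cy Cz.
have := vC _ _ m m01 Cy Cz => /=.
by have -> : (1 - m) * x + m * x = x by ring.
Qed.

End compact_sections.

(** The one-dimensional inequality applied to two vertical sections; their positive length makes
    them nonempty. *)
Lemma section_length_interpolate {R : realType} (A B M : set (plane R)) (m x y : R) :
  compact A -> compact B -> compact M -> plane_convex A -> plane_convex B ->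
  0 <= m <= 1 ->
  (forall p q, A p -> B q ->
    M ((1 - m) * p.1 + m * q.1, (1 - m) * p.2 + m * q.2)) ->
  0 < section_length A x -> 0 < section_length B y ->
  (1 - m) * section_length A x + m * section_length B y <=
    section_length M ((1 - m) * x + m * y).
Proof.
move=> cA cB cM vA vB m01 ABM Ax By.
rewrite -lee_fin EFinD !EFinM -!section_lengthE //.
apply: lebesgue_measure_interpolate => //.
- exact: section_length_neq0.
- exact: section_length_neq0.
- exact: is_interval_xsection.
- exact: is_interval_xsection.
- exact: bounded_xsection.
- exact: bounded_xsection.
- exact: measurable_compact_xsection.
by move=> i j; rewrite /xsection /= !inE; exact: ABM.
Qed.

(** The section length is concave where it is positive: [section_length_interpolate] with all three
    bodies equal to [C]. *)
Lemma is_interval_superlevel {R : realType} (C : set (plane R)) (t : R) :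
  compact C -> plane_convex C -> 0 <= t ->
  is_interval [set x | t < section_length C x].
Proof.
move=> cC vC t0; apply: is_interval_segment => x y m m01 /= tx ty.
have : (1 - m) * section_length C x + m * section_length C y <=
    section_length C ((1 - m) * x + m * y).
  apply: section_length_interpolate => //; last 2 first.
  - exact: le_lt_trans tx.
  - exact: le_lt_trans ty.
  by move=> p q; exact: vC.
apply: lt_le_trans; move/andP: m01 => [m0 m1].
have [->|mn0] := eqVneq m 0; first by rewrite subr0 mul1r mul0r addr0.
have mp : 0 < m by rewrite lt_neqAle eq_sym mn0.
by nra.
Qed.

(* Normalizing the two
   section functions by their suprema [a0] and [b0], the superlevel sets of
   the section function of [M] contain the half-sums of those of [A] and [B],
   whence [area M >= F (a0 + b0)^2 / (4 a0 b0) >= F]. *)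
Lemma area_half_sum {R : realType} (A B M : set (plane R)) (F : R) :
  compact A -> compact B -> compact M -> plane_convex A -> plane_convex B ->
  0 < F -> area A = F%:E -> area B = F%:E ->
  (forall p q, A p -> B q -> M ((p.1 + q.1) / 2, (p.2 + q.2) / 2)) ->
  (F%:E <= area M)%E.
Proof.
move=> cA cB cM vA vB F0 aA aB ABM.
(* The supremum is positive, since otherwise all sections would be null and the area would be
   [0]. *)
have supP (C : set (plane R)) : compact C -> area C = F%:E ->
    exists a0 : R, [/\ 0 < a0, forall x, section_length C x <= a0 &
      forall t, t < a0 -> exists x, t < section_length C x].
  move=> cC aC.
  have [N N0 CN] := section_length_bounded C cC.
  pose S := range (section_length C).
  have hS : has_sup S.
    split; first by exists (section_length C 0), 0.
    by exists N => _ [x _ <-]; case: (CN x).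
  exists (sup S).
  have ub x : section_length C x <= sup S.
    by apply: ub_le_sup; [case: hS|exists x].
  split => //; last first.
    by move=> t /(sup_gt (proj1 hS))[_ [x _ <-] tx]; exists x.
  rewrite ltNge; apply/negP => s0.
  move: aC; rewrite area_section_length // integral0_eq; last first.
    move=> x _; congr (_%:E); apply/eqP.
    by rewrite eq_le section_length_ge0 // (le_trans (ub x)).
  by move=> [] /eqP; rewrite lt_eqF.
have [a0 [a0_gt0 leA exA]] := supP A cA aA.
have [b0 [b0_gt0 leB exB]] := supP B cB aB.
(* As [c] bounds the section lengths, the truncation at [1] in the layer-cake formula changes
   nothing. *)
have normalized (C : set (plane R)) (c : R) : compact C -> area C = F%:E -> 0 < c ->
    (forall x, section_length C x <= c) ->
    (\int[@lebesgue_measure R]_(s in `[0%R, 1%R[)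
       lebesgue_measure [set x | (s * c < section_length C x)%R] = (F / c)%R%:E)%E.
  move=> cC aC c0 lec.
  rewrite integral_superlevel_length //; last 2 first.
  - exact: measurable_section_length.
  - exact: section_length_ge0.
  transitivity (\int[@lebesgue_measure R]_x (c^-1%R%:E * (section_length C x)%:E))%E.
    apply: eq_integral => x _; rewrite -EFinM [c^-1 * _]mulrC; congr (_%:E).
    by apply/min_idPr; rewrite ler_pdivrMr // mul1r.
  rewrite ge0_integralZl_EFin //.
  - by rewrite -area_section_length // aC -EFinM mulrC.
  - by move=> x _; rewrite lee_fin section_length_ge0.
  - by apply/measurable_EFinP; exact: measurable_section_length.
  - by rewrite invr_ge0 ltW.
(* With this scale, [s * k] is the mean of the levels [s * a0] and [s * b0]. *)
pose k := (a0 + b0) / 2.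
have k0 : 0 < k by rewrite divr_gt0 // addr_gt0.
pose L (C : set (plane R)) (c s : R) :=
  lebesgue_measure [set x | (s * c < section_length C x)%R].
have mL (C : set (plane R)) c : compact C -> measurable_fun
    (`[0%R, 1%R[%classic : set (measurableTypeR R)) (L C c).
  move=> cC; apply: measurable_superlevel_length.
  exact: measurable_section_length.
have half1 : 1 - 2^-1 = 2^-1 :> R by lra.
have half01 : 0 <= (2^-1 : R) <= 1 by apply/andP; split; lra.
have ABM' p q : A p -> B q ->
    M ((1 - 2^-1) * p.1 + 2^-1 * q.1, (1 - 2^-1) * p.2 + 2^-1 * q.2).
  move=> Ap Bq; rewrite half1.
  have := ABM p q Ap Bq; rewrite !(mulrC _ 2^-1) !mulrDr; exact.
(* For [s < 1] both superlevel sets are nonempty, [a0] and [b0] being suprema; the one-dimensional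
   inequality is used once more, now on the sets of abscissas. *)
have levels s : 0 <= s < 1 ->
    (2^-1%R%:E * L A a0 s + 2^-1%R%:E * L B b0 s <= L M k s)%E.
  move=> /andP[s0 s1]; rewrite -[X in (X%:E * L A _ _)%E]half1.
  have sa : 0 <= s * a0 by rewrite mulr_ge0 // ltW.
  have sb : 0 <= s * b0 by rewrite mulr_ge0 // ltW.
  apply: lebesgue_measure_interpolate => //.
  - by apply: exA; rewrite gtr_pMl.
  - by apply: exB; rewrite gtr_pMl.
  - exact: is_interval_superlevel.
  - exact: is_interval_superlevel.
  - exact: bounded_superlevel.
  - exact: bounded_superlevel.
  - rewrite -[X in measurable X]setTI.
    exact: (measurable_fun_ltr (measurable_cst _) (measurable_section_length M cM)).
  move=> i j /= Ai Bj.
  apply: (@lt_le_trans _ _ ((1 - 2^-1) * section_length A i + 2^-1 * section_length B j)).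
    by rewrite /k; lra.
  apply: section_length_interpolate => //.
  - exact: le_lt_trans Ai.
  - exact: le_lt_trans Bj.
have half0 : 0 <= (2^-1 : R) by lra.
have main : (2^-1%R%:E * (F / a0)%R%:E + 2^-1%R%:E * (F / b0)%R%:E <= k^-1%R%:E * area M)%E.
  rewrite -(normalized A a0) // -(normalized B b0) //.
  rewrite (area_section_length M) // -!ge0_integralZl_EFin //; try exact: mL;
    try (by move=> x _; rewrite lee_fin section_length_ge0);
    try (by apply/measurable_EFinP; exact: measurable_section_length);
    try by rewrite invr_ge0 ltW.
  rewrite -ge0_integralD //; last 4 first.
  - by move=> s _; rewrite mule_ge0.
  - by apply: measurable_funeM; exact: mL.
  - by move=> s _; rewrite mule_ge0.
  - by apply: measurable_funeM; exact: mL.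
  apply: (@le_trans _ _ (\int[@lebesgue_measure R]_(s in `[0%R, 1%R[) L M k s)%E).
    apply: ge0_le_integral => //.
    - by move=> s _; rewrite adde_ge0 // mule_ge0.
    - by apply: emeasurable_funD; apply: measurable_funeM; exact: mL.
    - exact: mL.
  (* Sections of [M] may be longer than [k]; the truncation at [1] then only lowers the integral, as
     the upper bound requires. *)
  rewrite integral_superlevel_length //; last 2 first.
  - exact: measurable_section_length.
  - exact: section_length_ge0.
  apply: ge0_le_integral => //.
  - by move=> x _; rewrite lee_fin le_min ler01 divr_ge0 ?section_length_ge0 // ltW.
  - apply/measurable_EFinP; apply: measurable_minr => //.
    apply: measurable_funM => //; exact: measurable_section_length.
  - by apply: measurable_funeM; apply/measurable_EFinP; exact: measurable_section_length.
  - by move=> x _; rewrite -EFinM lee_fin ge_min mulrC lexx orbT.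
have : (k%:E * (2^-1%R%:E * (F / a0)%R%:E + 2^-1%R%:E * (F / b0)%R%:E) <= area M)%E.
  apply: (@le_trans _ _ (k%:E * (k^-1%R%:E * area M))%E).
    by apply: lee_wpmul2l => //; rewrite lee_fin ltW.
  by rewrite muleA -EFinM divff ?gt_eqF // mul1e.
apply: le_trans.
rewrite -[leRHS]/((k * (2^-1 * (F / a0) + 2^-1 * (F / b0)))%:E) lee_fin.
have -> : k * (2^-1 * (F / a0) + 2^-1 * (F / b0)) =
    F * ((a0 + b0) ^+ 2 / (4 * (a0 * b0))).
  by rewrite /k; field; rewrite !gt_eqF.
(* The factor of [F] is at least [1] because [(a0 - b0) ^+ 2] is nonnegative. *)
rewrite -[leLHS]mulr1 ler_pM2l // ler_pdivlMr ?mul1r.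
  by have := sqr_ge0 (a0 - b0); lra.
by rewrite mulr_gt0 // mulr_gt0.
Qed.

(** * Area of a disc *)

(* The substitution [x = c + r sin t] removes the singularity of the section
   lengths at the end points of the disc. *)
Lemma area_disc_le {R : realType} (c : plane R) (r : R) (M : set (plane R)) :
  0 < r -> plane_measurable M ->
  (forall q, M q -> (q.1 - c.1) ^+ 2 + (q.2 - c.2) ^+ 2 <= r ^+ 2) ->
  (area M <= (pi * r ^+ 2)%:E)%E.
Proof.
move=> r0 mM MD.
(* The length of the vertical chord of the disc. [Num.sqrt] is [0] on negative numbers, so [g] is
   continuous on the whole line. *)
pose g (x : R) : R := 2 * Num.sqrt (r ^+ 2 - (x - c.1) ^+ 2).
pose f (t : R) : R := c.1 + r * sin t.
have cg : continuous g.
  move=> x; apply: cvgM; first exact: cvg_cst.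
  apply: (@continuous_comp _ _ _ (fun x => r ^+ 2 - (x - c.1) ^+ 2) Num.sqrt);
    last exact: sqrt_continuous.
  apply: cvgB; first exact: cvg_cst.
  by rewrite expr2; apply: cvgM; apply: cvgB; try exact: cvg_cst; exact: cvg_id.
have df (t : R) : is_derive t 1 f (r * cos t).
  rewrite /f; apply: is_derive_eq; by rewrite /GRing.scale /= add0r mul1r.
have f'E : (derive1 f) = (fun t => r * cos t).
  by apply/funext => t; rewrite derive1E; exact: derive_val.
have cf' : continuous (derive1 f).
  rewrite f'E => t; apply: cvgM; [exact: cvg_cst|exact: continuous_cos].
have cf : continuous f.
  by move=> t; apply: differentiable_continuous; apply/derivable1_diffP; case: (df t).
have pipos : 0 < pi :> R := pi_gt0 R.
have fl : f (- (pi / 2)) = c.1 - r by rewrite /f sinN sin_pihalf mulrN1.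
have fr : f (pi / 2) = c.1 + r by rewrite /f sin_pihalf mulr1.
apply: (@le_trans _ _ (\int[@lebesgue_measure R]_(x in `[(c.1 - r)%R, (c.1 + r)%R]) (g x)%:E)%E).
  rewrite area_xsection [leRHS]integral_mkcond.
  apply: ge0_le_integral => //.
  - exact: (measurable_fun_xsection (@lebesgue_measure R)).
  - apply: (@measurable_restrictT _ _ _ _ _ _ _).1; first exact: measurable_itv.
    apply: measurable_funTS; apply/measurable_EFinP.
    exact: continuous_measurable_fun.
  (* Over the projection of the disc the section of [M] lies in the chord; elsewhere it is empty. *)
  - move=> x _.
    have [hx|hx] := lerP ((x - c.1) ^+ 2) (r ^+ 2).
      rewrite patchE ifT; last first.
        rewrite inE /= in_itv/=.
        have : `|x - c.1| <= r.
          by rewrite -sqrtr_sqr -(ger0_norm (ltW r0)) -(sqrtr_sqr r) ler_wsqrtr.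
        by rewrite ler_norml => /andP[? ?]; apply/andP; split; lra.
      have -> : g x = (c.2 + Num.sqrt (r ^+ 2 - (x - c.1) ^+ 2)) -
          (c.2 - Num.sqrt (r ^+ 2 - (x - c.1) ^+ 2)) by rewrite /g; ring.
      apply: lebesgue_measure_le_diam.
      + by have := sqrtr_ge0 (r ^+ 2 - (x - c.1) ^+ 2); lra.
      + move=> y; rewrite /xsection /= inE => /MD /= h.
        have : `|y - c.2| <= Num.sqrt (r ^+ 2 - (x - c.1) ^+ 2).
          by rewrite -sqrtr_sqr ler_wsqrtr // lerBrDl.
        by rewrite in_itv/= ler_norml => /andP[? ?]; apply/andP; split; lra.
      exact: measurable_xsection.
    rewrite (_ : xsection M x = set0) ?measure0.
      by rewrite patchE; case: ifPn => // _; rewrite lee_fin mulr_ge0 // sqrtr_ge0.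
    apply/seteqP; split => y; rewrite /xsection //= inE => /MD /= h.
    by have := sqr_ge0 (y - c.2); move: h hx; lra.
rewrite -fl -fr integration_by_substitution_increasing.
(* On the range of [t], [h] is [g (f t)] times the derivative of [f]; [H] is a primitive of it
   because [1 + cos^2 - sin^2 = 2 cos^2]. *)
- pose h (t : R) : R := 2 * r ^+ 2 * cos t ^+ 2.
  pose H (t : R) : R := r ^+ 2 * (t + sin t * cos t).
  have dH (t : R) : is_derive t 1 H (h t).
    rewrite /H; apply: is_derive_eq.
    by have := cos2Dsin2 t; rewrite /h /GRing.scale /= => e; nra.
  rewrite (_ : (\int[_]_(x in _) _)%E =
     (\int[@lebesgue_measure R]_(x in `[(- (pi / 2))%R, (pi / 2)%R]) (h x)%:E)%E).
    rewrite (@continuous_FTC2 _ h H).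
    + rewrite /H sin_pihalf sinN sin_pihalf cosN cos_pihalf -EFinB lee_fin.
      by rewrite !mulr0 !addr0; lra.
    + by lra.
    + apply: continuous_subspaceT => t; rewrite /h.
      apply: cvgM; first exact: cvg_cst.
      by rewrite expr2; apply: cvgM; exact: continuous_cos.
    + split.
      * by move=> t _; case: (dH t).
      * apply: cvg_at_right_filter.
        by apply: differentiable_continuous; apply/derivable1_diffP; case: (dH (- (pi / 2))).
      * apply: cvg_at_left_filter.
        by apply: differentiable_continuous; apply/derivable1_diffP; case: (dH (pi / 2)).
    + by move=> t _; rewrite derive1E; exact: derive_val.
  apply: eq_integral => t; rewrite inE /= in_itv/= => ht; congr (_%:E).
  have ft : f t - c.1 = r * sin t by rewrite /f addrAC subrr add0r.
  rewrite f'E -[LHS]/(g (f t) * (r * cos t)) /g ft exprMn.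
  rewrite -[r ^+ 2 in X in X - _]mulr1 -mulrBr -cos2sin2.
  have c0 : 0 <= cos t by apply: cos_ge0_pihalf.
  rewrite sqrtrM ?sqr_ge0 // !sqrtr_sqr !ger0_norm // ?ltW //.
  by rewrite /h; ring.
- by lra.
- move=> x y; rewrite !in_itv/= => hx hy xy.
  rewrite /f ltrD2l ltr_pM2l //.
  by rewrite ltr_sin // in_itv/=.
- by move=> t _; exact: cf'.
- by apply/cvg_ex; exists (derive1 f (- (pi / 2))); apply: cvg_at_right_filter; exact: cf'.
- by apply/cvg_ex; exists (derive1 f (pi / 2)); apply: cvg_at_left_filter; exact: cf'.
- split.
  + by move=> t _; case: (df t).
  + by apply: cvg_at_right_filter; exact: cf.
  + by apply: cvg_at_left_filter; exact: cf.
- exact: continuous_subspaceT.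
Qed.

(** * Visual angle and support lines *)

(** The scalar product of [q] with the unit normal [(- sin t, cos t)]; its level sets are the lines
    of direction [t]. *)
Definition height {R : realType} (t : R) (q : plane R) : R :=
  cos t * q.2 - sin t * q.1.

Lemma polar_angle {R : realType} (x y : R) : x ^+ 2 + y ^+ 2 = 1 ->
  exists t, cos t = x /\ sin t = y.
Proof.
move=> xy1.
have x1 : -1 <= x <= 1.
  by rewrite -ler_norml -sqrtr_sqr -[leRHS]sqrtr1 ler_wsqrtr // -xy1 lerDl sqr_ge0.
have e : sin (acos x) = `|y|.
  by rewrite sin_acos // -xy1 addrAC subrr add0r sqrtr_sqr.
have [y0|y0] := lerP 0 y.
  by exists (acos x); rewrite acosK ?in_itv// e ger0_norm.
by exists (- acos x); rewrite cosN sinN acosK ?in_itv// e ltr0_norm // opprK.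
Qed.

(** In the orthonormal frame of direction [psi] at [P] the point [q] has coordinates [xi] and [eta].
    The first half-plane puts its polar angle in [[0, pi]], the second keeps it from exceeding
    [al]. *)
Lemma wedge_sub_sector {R : realType} (P q : plane R) (psi al : R) :
  0 < al < pi -> height psi P <= height psi q ->
  height (psi + al) q <= height (psi + al) P -> sector P psi al q.
Proof.
case: P q => [p1 p2] [q1 q2] /andP[al0 alpi]; rewrite /height /= => h1 h2.
have tr := cos2Dsin2 psi.
pose xi := cos psi * (q1 - p1) + sin psi * (q2 - p2).
pose eta := cos psi * (q2 - p2) - sin psi * (q1 - p1).
have eta0 : 0 <= eta by rewrite /eta; lra.
have hx : q1 = p1 + (cos psi * xi - sin psi * eta).
  transitivity (p1 + (cos psi ^+ 2 + sin psi ^+ 2) * (q1 - p1)); last by rewrite /xi /eta; ring.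
  by rewrite tr; ring.
have hy : q2 = p2 + (sin psi * xi + cos psi * eta).
  transitivity (p2 + (cos psi ^+ 2 + sin psi ^+ 2) * (q2 - p2)); last by rewrite /xi /eta; ring.
  by rewrite tr; ring.
have wedge : cos al * eta <= sin al * xi.
  rewrite -subr_ge0.
  have -> : sin al * xi - cos al * eta =
      - ((cos psi * cos al - sin psi * sin al) * (q2 - p2)
       - (sin psi * cos al + cos psi * sin al) * (q1 - p1)) by rewrite /xi /eta; ring.
  by rewrite -cosD -sinD; lra.
pose s := Num.sqrt (xi ^+ 2 + eta ^+ 2).
have s0 : 0 <= s := sqrtr_ge0 _.
have s2 : s ^+ 2 = xi ^+ 2 + eta ^+ 2 by rewrite sqr_sqrtr // addr_ge0 // sqr_ge0.
(* At distance [0] the point is the vertex, and any angle of the sector serves. *)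
have [se|sn] := eqVneq s 0.
  move: s2; rewrite se expr0n /= => /esym/eqP.
  rewrite paddr_eq0 ?sqr_ge0 // !sqrf_eq0 => /andP[/eqP xi0 /eqP et0].
  exists 0, psi; split => //; first by rewrite lexx lerDl ltW.
  by rewrite hx hy xi0 et0 /= !mul0r !mulr0 subr0 !addr0.
have sp : 0 < s by rewrite lt_neqAle eq_sym sn.
have ns : (xi / s) ^+ 2 + (eta / s) ^+ 2 = 1.
  by rewrite !expr_div_n -mulrDl -s2 divff // expf_neq0.
have x1 : -1 <= xi / s <= 1.
  by rewrite -ler_norml -sqrtr_sqr -[leRHS]sqrtr1 ler_wsqrtr // -ns lerDl sqr_ge0.
pose tau := acos (xi / s).
have ct : cos tau = xi / s by rewrite acosK ?in_itv.
have st : sin tau = eta / s.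
  rewrite sin_acos // -ns addrAC subrr add0r sqrtr_sqr ger0_norm //.
  by rewrite divr_ge0.
have tau0 : 0 <= tau := acos_ge0 x1.
have taupi : tau <= pi := acos_lepi x1.
(* An angle beyond [al] would make [sin (tau - al)] positive, against [wedge]. *)
have tau_al : tau <= al.
  rewrite leNgt; apply/negP => alt.
  have : 0 < sin (tau - al) by apply: sin_gt0_pi; rewrite ?subr_gt0 ?alt //; lra.
  rewrite sinB ct st.
  have -> : eta / s * cos al - xi / s * sin al = (cos al * eta - sin al * xi) / s by ring.
  by rewrite pmulr_lgt0 ?invr_gt0 // subr_gt0 ltNge wedge.
exists s, (psi + tau); split => //.
  by rewrite lerDl tau0 lerD2l tau_al.
have eX : s * (xi / s) = xi by rewrite mulrC divfK.
have eY : s * (eta / s) = eta by rewrite mulrC divfK.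
by rewrite cosD sinD ct st /= hx hy -{1}eX -{1}eY -{2}eX -{2}eY; congr pair; ring.
Qed.

Lemma direction_of_ray {R : realType} (r s t u : R) : 0 <= r -> 0 < s ->
  r * cos t = s * cos u -> r * sin t = s * sin u -> cos t = cos u /\ sin t = sin u.
Proof.
move=> r0 s0 ec es.
have rs2 : r ^+ 2 = s ^+ 2.
  transitivity ((r * cos t) ^+ 2 + (r * sin t) ^+ 2).
    by rewrite !exprMn -mulrDr cos2Dsin2 mulr1.
  by rewrite ec es !exprMn -mulrDr cos2Dsin2 mulr1.
have rs : r = s by apply: (pexpIrn (ltn0Sn 1)) => //; rewrite nnegrE // ltW.
have sn : s != 0 by rewrite gt_eqF.
by split; apply: (mulfI sn); rewrite -[in LHS]rs.
Qed.

(** The points [q1] and [q2] lie on the two bounding rays of the wedge. Their angles in the sector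
    are determined only up to full turns, so the comparison is made between cosines, which decrease
    strictly on [[0, pi]]. *)
Lemma sector_opening_ge {R : realType} (P q1 q2 : plane R) (psi al th w : R) :
  0 < al < pi -> 0 <= w -> q1 <> P -> q2 <> P ->
  height psi q1 = height psi P -> height (psi + al) q1 <= height (psi + al) P ->
  height psi P <= height psi q2 -> height (psi + al) q2 = height (psi + al) P ->
  sector P th w q1 -> sector P th w q2 -> al <= w.
Proof.
case: P q1 q2 => [p1 p2] [x1 y1] [x2 y2] /andP[al0 alpi] w0.
rewrite /height /= => n1 n2 h1 h1' h2 h2' [r1 [t1 [r10 t1b [ex1 ey1]]]]
  [r2 [t2 [r20 t2b [ex2 ey2]]]].
have sal : 0 < sin al by apply: sin_gt0_pi; rewrite al0.
have tr := cos2Dsin2 psi.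
have tr' := cos2Dsin2 (psi + al).
have sE : sin al = sin (psi + al) * cos psi - cos (psi + al) * sin psi.
  by rewrite -sinB addrC addKr.
pose xi := cos psi * (x1 - p1) + sin psi * (y1 - p2).
have hx1 : x1 - p1 = xi * cos psi.
  transitivity ((cos psi ^+ 2 + sin psi ^+ 2) * (x1 - p1) +
    sin psi * (cos psi * y1 - sin psi * x1 - (cos psi * p2 - sin psi * p1))).
    by rewrite tr h1; ring.
  by rewrite /xi; ring.
have hy1 : y1 - p2 = xi * sin psi.
  transitivity ((cos psi ^+ 2 + sin psi ^+ 2) * (y1 - p2) -
    cos psi * (cos psi * y1 - sin psi * x1 - (cos psi * p2 - sin psi * p1))).
    by rewrite tr h1; ring.
  by rewrite /xi; ring.
pose ze := cos (psi + al) * (x2 - p1) + sin (psi + al) * (y2 - p2).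
have hx2 : x2 - p1 = ze * cos (psi + al).
  transitivity ((cos (psi + al) ^+ 2 + sin (psi + al) ^+ 2) * (x2 - p1) +
    sin (psi + al) * (cos (psi + al) * y2 - sin (psi + al) * x2
      - (cos (psi + al) * p2 - sin (psi + al) * p1))).
    by rewrite tr' h2'; ring.
  by rewrite /ze; ring.
have hy2 : y2 - p2 = ze * sin (psi + al).
  transitivity ((cos (psi + al) ^+ 2 + sin (psi + al) ^+ 2) * (y2 - p2) -
    cos (psi + al) * (cos (psi + al) * y2 - sin (psi + al) * x2
      - (cos (psi + al) * p2 - sin (psi + al) * p1))).
    by rewrite tr' h2'; ring.
  by rewrite /ze; ring.
(* [q1] differs from [P] and is on the right side of the other line, so it lies on the positive half
   of its own line. *)
have xi0 : 0 < xi.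
  rewrite lt_neqAle; apply/andP; split.
    apply/eqP => e; apply: n1; congr pair; apply/eqP; rewrite -subr_eq0; apply/eqP.
      by rewrite [LHS]hx1 -e mul0r.
    by rewrite [LHS]hy1 -e mul0r.
  have : 0 <= sin al * xi.
    have -> : sin al * xi = sin (psi + al) * (xi * cos psi) - cos (psi + al) * (xi * sin psi).
      by rewrite sE; ring.
    by rewrite -hx1 -hy1; lra.
  by rewrite pmulr_rge0.
have ze0 : 0 < ze.
  rewrite lt_neqAle; apply/andP; split.
    apply/eqP => e; apply: n2; congr pair; apply/eqP; rewrite -subr_eq0; apply/eqP.
      by rewrite [LHS]hx2 -e mul0r.
    by rewrite [LHS]hy2 -e mul0r.
  have : 0 <= sin al * ze.
    have -> : sin al * ze = cos psi * (ze * sin (psi + al)) - sin psi * (ze * cos (psi + al)).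
      by rewrite sE; ring.
    by rewrite -hx2 -hy2; lra.
  by rewrite pmulr_rge0.
have [c1 s1] : cos t1 = cos psi /\ sin t1 = sin psi.
  by apply: (direction_of_ray r1 xi) => //; [rewrite -hx1 ex1|rewrite -hy1 ey1]; ring.
have [c2 s2] : cos t2 = cos (psi + al) /\ sin t2 = sin (psi + al).
  by apply: (direction_of_ray r2 ze) => //; [rewrite -hx2 ex2|rewrite -hy2 ey2]; ring.
have cE : cos `|t2 - t1| = cos al.
  rewrite cos_norm cosB c1 s1 c2 s2 -cosB.
  by rewrite addrC addKr.
rewrite leNgt; apply/negP => wal.
have tw : `|t2 - t1| <= w.
  by move/andP: t1b => [? ?]; move/andP: t2b => [? ?]; rewrite ler_norml; apply/andP; split; lra.
have : cos al < cos `|t2 - t1|.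
  rewrite ltr_cos ?in_itv/= ?normr_ge0 ?(le_lt_trans tw) ?(ltW al0) ?(ltW alpi) //.
  by rewrite (le_trans tw) // ltW // (lt_trans wal).
by rewrite cE ltxx.
Qed.

(** Fermat's rule: a linear functional with a local minimum along the graph has its normal
    orthogonal to the tangent. *)
Lemma affine_graph_tangent {R : realType} (g : R -> R) (a b x0 : R) :
  (\forall x \near x0, derivable g x 1) ->
  (\forall x \near x0, a * g x0 + b * x0 <= a * g x + b * x) ->
  a * derive1 g x0 + b = 0.
Proof.
move=> dg mg.
have : nbhs x0 [set x | derivable g x 1 /\ a * g x0 + b * x0 <= a * g x + b * x].
  exact: filterI dg mg.
move=> /nbhs_ballP[e /= e0 H].
pose phi (x : R) : R := a * g x + b * x.
have inball t : t \in `](x0 - e), (x0 + e)[ -> ball x0 e t.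
  rewrite in_itv/= => /andP[t1 t2].
  by rewrite /ball /= ltr_norml; apply/andP; split; lra.
have dphi t : derivable g t 1 -> is_derive t 1 phi (a * derive1 g t + b).
  move=> /derivableP dgt; rewrite derive1E /phi; apply: is_derive_eq.
  by rewrite /GRing.scale /= mulr1.
have x0in : x0 \in `](x0 - e), (x0 + e)[ by rewrite in_itv/= ltrBlDr !ltrDl e0.
have min_phi : is_derive x0 1 phi 0.
  apply: (@derive1_at_min _ phi (x0 - e) (x0 + e)) => //.
  - lra.
  - by move=> t /inball /H[dt _]; case: (dphi t dt).
  - by move=> t /inball /H[].
have [dx0 _] := H _ (inball _ x0in).
have e1 : derive1 phi x0 = a * derive1 g x0 + b.
  by rewrite derive1E; have := dphi x0 dx0 => h; exact: derive_val.
by rewrite -e1 derive1E; exact: derive_val.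
Qed.

(** If [P] were in [K], two support lines of different directions would pass through this boundary
    point; both would be tangent to the graph that represents the boundary, which has only one
    tangent there. *)
Lemma C2_boundary_no_corner {R : realType} (K : set (plane R)) (P : plane R) (psi al : R) :
  closed K -> C2_boundary K -> sin al != 0 ->
  (forall q, K q -> height psi P <= height psi q) ->
  (forall q, K q -> height (psi + al) q <= height (psi + al) P) -> ~ K P.
Proof.
move=> cK bK sal h1 h2 KP.
have sE : sin al = sin (psi + al) * cos psi - cos (psi + al) * sin psi.
  by rewrite -sinB addrC addKr.
have bKK q : boundary K q -> K q by move=> [+ _]; rewrite -((closure_id K).1 cK).
have bP : boundary K P.
  split; first exact: subset_closure.
  move=> iP.
  (* Moving from [P] against the normal of direction [psi] lowers the height, so no neighbourhood of
     [P] is contained in [K]. *)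
  pose gam (t : R) : plane R := (P.1 + sin psi * t, P.2 - cos psi * t).
  have cgam : gam t @[t --> (0 : R)] --> P.
    have -> : P = gam 0 by rewrite /gam !mulr0 addr0 subr0; case: (P).
    apply: (@cvg_pair _ _ _ _ (nbhs (P.1 + sin psi * 0 : R^o))
      (nbhs (P.2 - cos psi * 0 : R^o))).
      by apply: cvgD; [exact: cvg_cst|apply: cvgM; [exact: cvg_cst|exact: cvg_id]].
    by apply: cvgB; [exact: cvg_cst|apply: cvgM; [exact: cvg_cst|exact: cvg_id]].
  have : nbhs (0 : R) (gam @^-1` K) by exact: cgam.
  move=> /nbhs_ballP[e /= e0 H].
  have /H /h1 : ball (0 : R) e (e / 2).
    by rewrite /ball /= sub0r normrN ger0_norm; lra.
  rewrite /height /gam /= leNgt => /negP; apply.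
  have tr := cos2Dsin2 psi.
  rewrite (_ : cos psi * (P.2 - _) - _ = cos psi * P.2 - sin psi * P.1 -
    (cos psi ^+ 2 + sin psi ^+ 2) * (e / 2)); last by ring.
  by rewrite tr mul1r ltrBlDr ltrDl divr_gt0.
case: (bK P bP) => -[g [dg near_g]].
- have gP : P.2 = g P.1 by apply/(nbhs_singleton near_g).
  have dgn : \forall x \near P.1, derivable g x 1 by apply: filterS dg => t [].
  have cg : {for P.1, continuous g}.
    by apply: differentiable_continuous; apply/derivable1_diffP; exact: nbhs_singleton dgn.
  have cgam : ((x, g x) : plane R) @[x --> P.1] --> P.
    have {2}-> : P = (P.1, g P.1) by rewrite -gP; case: (P).
    by apply: (@cvg_pair _ _ _ _ (nbhs (P.1 : R^o)) (nbhs (g P.1 : R^o)));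
      [exact: cvg_id|exact: cg].
  have nK : \forall x \near P.1, K (x, g x).
    have : nbhs P.1 [set x | boundary K (x, g x) <-> g x = g x] by exact: cgam near_g.
    by apply: filterS => x [_ /(_ erefl)]; exact: bKK.
  (* Both normals are orthogonal to the tangent vector [(1, g')], hence parallel, which forces
     [sin al = 0]. *)
  have t1 : cos psi * derive1 g P.1 + - sin psi = 0.
    apply: affine_graph_tangent => //; apply: filterS nK => x /h1.
    by rewrite /height /= gP !mulNr.
  have t2 : - cos (psi + al) * derive1 g P.1 + sin (psi + al) = 0.
    apply: affine_graph_tangent => //; apply: filterS nK => x /h2.
    by rewrite /height /= gP !mulNr; lra.
  move/eqP: sal; apply; rewrite sE.
  have -> : sin (psi + al) = cos (psi + al) * derive1 g P.1 by lra.
  have -> : sin psi = cos psi * derive1 g P.1 by lra.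
  by ring.
(* Same argument for a graph over the second axis, with tangent vector [(g', 1)]. *)
- have gP : P.1 = g P.2 by apply/(nbhs_singleton near_g).
  have dgn : \forall x \near P.2, derivable g x 1 by apply: filterS dg => t [].
  have cg : {for P.2, continuous g}.
    by apply: differentiable_continuous; apply/derivable1_diffP; exact: nbhs_singleton dgn.
  have cgam : ((g x, x) : plane R) @[x --> P.2] --> P.
    have {2}-> : P = (g P.2, P.2) by rewrite -gP; case: (P).
    by apply: (@cvg_pair _ _ _ _ (nbhs (g P.2 : R^o)) (nbhs (P.2 : R^o)));
      [exact: cg|exact: cvg_id].
  have nK : \forall x \near P.2, K (g x, x).
    have : nbhs P.2 [set x | boundary K (g x, x) <-> g x = g x] by exact: cgam near_g.
    by apply: filterS => x [_ /(_ erefl)]; exact: bKK.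
  have t1 : - sin psi * derive1 g P.2 + cos psi = 0.
    apply: affine_graph_tangent => //; apply: filterS nK => x /h1.
    by rewrite /height /= gP !mulNr; lra.
  have t2 : sin (psi + al) * derive1 g P.2 + - cos (psi + al) = 0.
    apply: affine_graph_tangent => //; apply: filterS nK => x /h2.
    by rewrite /height /= gP !mulNr; lra.
  move/eqP: sal; apply; rewrite sE.
  have -> : cos (psi + al) = sin (psi + al) * derive1 g P.2 by lra.
  have -> : cos psi = sin psi * derive1 g P.2 by lra.
  by ring.
Qed.

(** The wedge is contained in a sector of opening [al], and the contact points [q1] and [q2] prevent
    any sector containing [K] from being narrower. *)
Lemma visual_angle_wedge {R : realType} (K : set (plane R)) (P q1 q2 : plane R) (psi al : R) :
  0 < al < pi -> ~ K P -> K q1 -> K q2 ->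
  (forall q, K q -> height psi P <= height psi q) ->
  (forall q, K q -> height (psi + al) q <= height (psi + al) P) ->
  height psi q1 = height psi P -> height (psi + al) q2 = height (psi + al) P ->
  visual_angle K P = al.
Proof.
move=> al01 nKP Kq1 Kq2 h1 h2 e1 e2.
rewrite /visual_angle; set S := [set w | _].
have Sal : S al.
  split; first by case/andP: al01 => /ltW.
  by exists psi => q Kq; apply: wedge_sub_sector => //; [exact: h1|exact: h2].
have lbS : lbound S al.
  move=> w [w0 [th Kth]].
  apply: (sector_opening_ge P q1 q2 psi al th w) => //;
    [by move=> e; apply: nKP; rewrite -e..|exact: h2|exact: h1|exact: Kth|exact: Kth].
apply/eqP; rewrite eq_le; apply/andP; split.
  by apply: ge_inf => //; exists al.
by apply: lb_le_inf => //; exists al.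
Qed.

Lemma continuous_height {R : realType} (t : R) : continuous (height t : plane R -> R).
Proof.
move=> q; rewrite /height.
by apply: cvgB; apply: cvgM; try exact: cvg_cst; [exact: cvg_snd|exact: cvg_fst].
Qed.

Lemma cosE_sin_half {R : realType} (x : R) : cos x = 1 - 2 * sin (x / 2) ^+ 2.
Proof.
rewrite {1}(_ : x = x / 2 + x / 2); last by rewrite -splitr.
by rewrite cosD -!expr2 cos2sin2; ring.
Qed.

(* The support lines of directions [psi] and [psi + al] meet at a point of the
   circle, and [n (psi + al) - n psi] has length [2 sin (al / 2)] for the unit
   normals [n]; conclude by Cauchy-Schwarz. *)
Lemma support_gap_le {R : realType} (K : set (plane R)) (c p q : plane R) (psi al rho : R) :
  compact K -> C2_boundary K -> 0 < al < pi -> 0 < rho ->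
  isotopic_set K al = circle c rho -> K p -> K q ->
  height (psi + al) p - height (psi + al) c - (height psi q - height psi c)
    <= 2 * (rho * sin (al / 2)).
Proof.
move=> cK bK al01 rho0 isoK Kp Kq.
have [al0 alpi] := andP al01.
have K0 : K !=set0 by exists p.
have [q1 /set_mem Kq1 min1] : exists2 q1, q1 \in K &
    forall q, q \in K -> height psi q1 <= height psi q.
  apply: compact_EVT_min => //.
  by apply: continuous_subspaceT; exact: continuous_height.
have [q2 /set_mem Kq2 max2] : exists2 q2, q2 \in K &
    forall q, q \in K -> height (psi + al) q <= height (psi + al) q2.
  apply: compact_EVT_max => //.
  by apply: continuous_subspaceT; exact: continuous_height.
have sal : 0 < sin al by apply: sin_gt0_pi; rewrite al0.
have sE : sin al = sin (psi + al) * cos psi - cos (psi + al) * sin psi.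
  by rewrite -sinB addrC addKr.
pose a := height psi q1; pose b := height (psi + al) q2.
(* Cramer's rule for the intersection of the two support lines, with determinant [sin al]. *)
pose P : plane R := ((a * cos (psi + al) - b * cos psi) / sin al,
                     (a * sin (psi + al) - b * sin psi) / sin al).
have Pa : height psi P = a.
  rewrite /height /P /=.
  transitivity (a * (sin (psi + al) * cos psi - cos (psi + al) * sin psi) / sin al); first by ring.
  by rewrite -sE mulfK // gt_eqF.
have Pb : height (psi + al) P = b.
  rewrite /height /P /=.
  transitivity (b * (sin (psi + al) * cos psi - cos (psi + al) * sin psi) / sin al); first by ring.
  by rewrite -sE mulfK // gt_eqF.
have h1 q' : K q' -> height psi P <= height psi q' by rewrite Pa => /mem_set; exact: min1.
have h2 q' : K q' -> height (psi + al) q' <= height (psi + al) P.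
  by rewrite Pb => /mem_set; exact: max2.
have nKP : ~ K P.
  apply: (C2_boundary_no_corner K P psi al) => //; last by rewrite gt_eqF.
  exact: compact_plane_closed.
have : isotopic_set K al P.
  by split => //; exact: (visual_angle_wedge K P q1 q2 psi al).
rewrite isoK /circle /= => circP.
apply: (@le_trans _ _ (height (psi + al) P - height (psi + al) c - (height psi P - height psi c))).
  by have := h1 q Kq; have := h2 p Kp; lra.
set X := P.1 - c.1 in circP *; set Y := P.2 - c.2 in circP *.
(* The coordinates of [n (psi + al) - n psi]. *)
pose N1 := sin psi - sin (psi + al); pose N2 := cos (psi + al) - cos psi.
rewrite (_ : _ - _ - _ = X * N1 + Y * N2); last by rewrite /height /X /Y /N1 /N2; ring.
have NN : N1 ^+ 2 + N2 ^+ 2 = (2 * sin (al / 2)) ^+ 2.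
  have cE : cos al = cos (psi + al) * cos psi + sin (psi + al) * sin psi.
    by rewrite -cosB addrC addKr.
  have := cosE_sin_half al; rewrite cE.
  by have := cos2Dsin2 psi; have := cos2Dsin2 (psi + al); rewrite /N1 /N2; lra.
have sh : 0 < sin (al / 2) by apply: sin_gt0_pi; rewrite ?divr_gt0 //; lra.
apply: le_trans (ler_norm _) _.
rewrite -(ger0_norm (_ : 0 <= 2 * (rho * sin (al / 2)))); last first.
  by rewrite mulr_ge0 // mulr_ge0 // ltW.
rewrite -!sqrtr_sqr ler_wsqrtr //.
have -> : (2 * (rho * sin (al / 2))) ^+ 2 = rho ^+ 2 * (2 * sin (al / 2)) ^+ 2 by ring.
rewrite -circP -NN -subr_ge0.
(* Lagrange's identity: the defect in Cauchy-Schwarz is a square. *)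
rewrite (_ : _ - _ = (X * N2 - Y * N1) ^+ 2); first exact: sqr_ge0.
by ring.
Qed.

(** * Rotations, half-sums and the final estimate *)

Lemma norm_le_of_heights {R : realType} (v : plane R) (r : R) : 0 < r ->
  (forall psi, - r <= height psi v) -> v.1 ^+ 2 + v.2 ^+ 2 <= r ^+ 2.
Proof.
case: v => x y r0 /= h.
pose s := Num.sqrt (x ^+ 2 + y ^+ 2).
have s2 : s ^+ 2 = x ^+ 2 + y ^+ 2 by rewrite sqr_sqrtr // addr_ge0 // sqr_ge0.
have [se|sn] := eqVneq s 0.
  by rewrite -[leLHS]s2 se expr0n /= sqr_ge0.
(* The direction whose normal is [- v / |v|]; there the height of [v] is [- s]. *)
have [t [ct st]] : exists t, cos t = - (y / s) /\ sin t = x / s.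
  apply: polar_angle; rewrite sqrrN !expr_div_n -mulrDl addrC -s2 divff //.
  by rewrite expf_neq0.
have := h t; rewrite /height /= ct st.
rewrite (_ : - (y / s) * y - _ = - ((x ^+ 2 + y ^+ 2) / s)); last by ring.
rewrite -s2 expr2 mulfK // lerN2 => sr.
by rewrite -expr2 ler_pXn2r ?nnegrE ?sqrtr_ge0 ?(ltW r0).
Qed.

Lemma height_rotation {R : realType} (t s : R) (q : plane R) :
  height t (rotation s q) = height (t - s) q.
Proof. by rewrite /height /rotation /= cosB sinB; ring. Qed.

Lemma rotationK {R : realType} (t : R) : cancel (@rotation R t) (rotation (- t)).
Proof.
case=> x y; rewrite /rotation /= cosN sinN.
have tr := cos2Dsin2 t.
congr pair.
  transitivity ((cos t ^+ 2 + sin t ^+ 2) * x); first by ring.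
  by rewrite tr mul1r.
transitivity ((cos t ^+ 2 + sin t ^+ 2) * y); first by ring.
by rewrite tr mul1r.
Qed.

Lemma compact_rotation_preimage {R : realType} (t : R) (K : set (plane R)) :
  compact K -> compact (rotation t @^-1` K).
Proof.
move=> cK.
have -> : rotation t @^-1` K = rotation (- t) @` K.
  apply/seteqP; split => [q Kq|_ [q Kq <-]].
    by exists (rotation t q) => //; exact: rotationK.
  by rewrite /preimage /= -[X in rotation X]opprK rotationK.
apply: continuous_compact => //.
by apply: continuous_subspaceT; exact: continuous_rotation.
Qed.

Lemma plane_convex_rotation_preimage {R : realType} (t : R) (K : set (plane R)) :
  plane_convex K -> plane_convex (rotation t @^-1` K).
Proof.
move=> vK p q m m01 Kp Kq; rewrite /preimage /=.
have := vK _ _ m m01 Kp Kq; rewrite /rotation /=.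
by congr (K _); congr pair; ring.
Qed.

Lemma plane_convexP {R : realType} (K : set (plane R)) : convex_set K -> plane_convex K.
Proof.
move=> vK p q m /andP[m0 m1] /mem_set Kp /mem_set Kq.
have n0 : 0 <= 1 - m by rewrite subr_ge0.
have n1 : 1 - m <= 1 by rewrite gerBl.
(* In [convex_set] the parameter is the weight of the first point, hence [1 - m]. *)
have /set_mem := vK _ _ (Itv01 n0 n1) Kp Kq.
have e : 1 - (1 - m) = m by ring.
congr (K _); congr pair; rewrite -[LHS]/(_ *: _ + (1 - (1 - m)) *: _) e.
  by [].
by [].
Qed.

Definition half_sum {R : realType} (A B : set (plane R)) : set (plane R) :=
  (fun pq : plane R * plane R =>
    ((pq.1.1 + pq.2.1) / 2, (pq.1.2 + pq.2.2) / 2) : plane R) @` (A `*` B).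

Lemma compact_half_sum {R : realType} (A B : set (plane R)) :
  compact A -> compact B -> compact (half_sum A B).
Proof.
move=> cA cB; apply: continuous_compact; last exact: compact_setX.
apply: continuous_subspaceT => pq.
have c1 : ((x.1 : plane R) @[x --> pq] --> pq.1) by exact: cvg_fst.
have c2 : ((x.2 : plane R) @[x --> pq] --> pq.2) by exact: cvg_snd.
apply: (@cvg_pair _ _ _ _ (nbhs ((pq.1.1 + pq.2.1) / 2 : R^o))
  (nbhs ((pq.1.2 + pq.2.2) / 2 : R^o)));
  apply: cvgM; try exact: cvg_cst; apply: cvgD.
- exact: (cvg_comp _ _ c1 cvg_fst).
- exact: (cvg_comp _ _ c2 cvg_fst).
- exact: (cvg_comp _ _ c1 cvg_snd).
- exact: (cvg_comp _ _ c2 cvg_snd).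
Qed.

Theorem theorem5p2 (R : realType) (K : set (plane R)) (F alpha rho : R)
  (hcompact : compact K) (hconvex : convex_set K) (hC2 : C2_boundary K)
  (harea : area K = F%:E)
  (halpha0 : 0 < alpha) (halphapi : alpha < pi) (hrho : 0 < rho)
  (hcircle : exists c : plane R, isotopic_set K alpha = circle c rho) :
  F <= pi * rho ^+ 2 * sin (alpha / 2) ^+ 2.
Proof.
have [c isoK] := hcircle.
(* The case of nonpositive [F] is separate because [area_half_sum] divides by suprema that are
   positive only for positive area. *)
have [F0|F0] := lerP F 0.
  by rewrite (le_trans F0) // mulr_ge0 ?sqr_ge0 // mulr_ge0 ?pi_ge0 ?sqr_ge0.
have al01 : 0 < alpha < pi by rewrite halpha0.
pose r := rho * sin (alpha / 2).
have r0 : 0 < r.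
  by rewrite mulr_gt0 // sin_gt0_pi // divr_gt0 //=; lra.
(* The summand [pi] reverses normals: the height of [rotation t b] in direction [psi + alpha] is
   minus the height of [b] in direction [psi]. The difference of heights in [support_gap_le] thus
   becomes a sum. *)
pose t := alpha + pi.
have st : sin t != 0 by rewrite sinDpi oppr_eq0 gt_eqF // sin_gt0_pi // halpha0.
pose B := rotation t @^-1` K.
pose M := half_sum K B.
have cB : compact B by exact: compact_rotation_preimage.
have cM : compact M by exact: compact_half_sum.
have vK : plane_convex K by exact: plane_convexP.
have FM : (F%:E <= area M)%E.
  apply: (area_half_sum K B M F) => //.
  - exact: plane_convex_rotation_preimage.
  - by rewrite area_rotation //; exact: compact_plane_closed.
  - by move=> p q Kp Bq; exists (p, q).
have [c' rc'] : exists c', rotation t c' = c.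
  by exists (rotation (- t) c); rewrite -[X in rotation X]opprK rotationK.
(* The centre of the disc is the half-sum of [c] and its counterpart [c'] for the rotated body. *)
pose d : plane R := ((c.1 + c'.1) / 2, (c.2 + c'.2) / 2).
have MD m : M m -> (m.1 - d.1) ^+ 2 + (m.2 - d.2) ^+ 2 <= r ^+ 2.
  move=> [[q b] [/= Kq Kb] <-].
  apply: (norm_le_of_heights ((q.1 + b.1) / 2 - d.1, (q.2 + b.2) / 2 - d.2) r r0) => psi.
  have := support_gap_le K c (rotation t b) q psi alpha rho hcompact hC2 al01 hrho isoK Kb Kq.
  rewrite -{1}rc' !height_rotation.
  rewrite (_ : psi + alpha - t = psi - pi); last by rewrite /t; ring.
  rewrite /height /d /= -/r !cosB !sinB cospi sinpi.
  by lra.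
rewrite -lee_fin; apply: (le_trans FM).
rewrite (_ : pi * rho ^+ 2 * sin (alpha / 2) ^+ 2 = pi * r ^+ 2); last by rewrite /r; ring.
apply: (area_disc_le d) => //.
by apply: closed_plane_measurable; exact: compact_plane_closed.
Qed.
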